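(* Let $N,M\ge0$ be integers such that $D_{N,M}$ is a pruning disk, let $f_{N,M}$ be a pruning homeomorphism associated to $D_{N,M}$, and let $\rho_{N,M}$ be the associated pruning automorphism. Suppose there exists a symmetric closed curve $\gamma$ in $\mathcal{H}^{\mathbb{C}}_0$ with $\gamma(0)\in\operatorname{DN}$ such that $\rho(\gamma)=\rho_{N,M}$, and put $(a,b)=\gamma(1/2)$. Then $H_{a,b}$ restricted to $K^{\mathbb{R}}_{a,b}$ is topologically conjugate to $f_{N,M}$ restricted to $\operatorname{NW}(f_{N,M})$.
   Context: H\'enon maps: $H_{a,b}(x,y)=(a-x^2-by,x)$ for $(a,b)\in\mathbb{C}\times\mathbb{C}^*$, acting on $\mathbb{C}^2$. $K^{\mathbb{C}}_{a,b}$ is the set of $p\in\mathbb{C}^2$ with bounded orbit $\{H^n_{a,b}(p)\}_{n\in\mathbb{Z}}$ and $K^{\mathbb{R}}_{a,b}=K^{\mathbb{C}}_{a,b}\cap\mathbb{R}^2$. $\Sigma_2=\{0,1\}^{\mathbb{Z}}$ with shift $\sigma$. The horseshoe locus $\mathcal{H}^{\mathbb{C}}$ is the set of $(a,b)\in\mathbb{C}\times\mathbb{C}^*$ such that $H_{a,b}|_{K^{\mathbb{C}}_{a,b}}$ is topologically conjugate to $(\sigma,\Sigma_2)$; $\mathcal{H}^{\mathbb{C}}_0$ is its connected component containing $\{(a,b):|a|>2(1+|b|)^2,\ b\ne0\}$. $\operatorname{DN}=\{(a,b)\in\mathbb{R}^2: a>(5+2\sqrt5)(1+|b|)^2/4,\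 b\neq0\}\subset\mathcal{H}^{\mathbb{C}}_0$. For a loop $\gamma$ in $\mathcal{H}^{\mathbb{C}}_0$ based at $\gamma(0)\in\operatorname{DN}$, fixing a conjugacy $h_0\colon K^{\mathbb{C}}_{\gamma(0)}\to\Sigma_2$ and continuing it by structural stability gives conjugacies $h_t\colon K^{\mathbb{C}}_{\gamma(t)}\to\Sigma_2$ with $\sigma\circ h_t=h_t\circ H_{\gamma(t)}$; the monodromy is the shift automorphism $\rho(\gamma)=h_1\circ h_0^{-1}$. The loop $\gamma$ is symmetric if $\gamma(1-t)=\overline{\gamma(t)}$ (coordinatewise complex conjugation) for all $t\in[0,1]$; then $\gamma(1/2)\in\mathbb{R}^2$. Smale horseshoe $F$: the standard horseshoe diffeomorphism of the plane on $Q=[-1,1]^2$ with uniform expansion $\lambda>2$ horizontally and contraction $\mu<1/2$ vertically, whose non-wandering set $\operatorname{NW}(F)$ is a Cantor set conjugated to $(\sigma,\Sigma_2)$ by the itinerary map $\vartheta(z)_i=0$ if the first coordinate of $F^i(z)$ is negative, $1$ if positive; $0^\infty$ is the fixed point with all-zero code, $0^k$ denotes $k$ zeros. A pruning disk is an open topological disk $D$ with closed-disk closure and $\partial D=C\cup E$ (arcs meeting only at endpoints) such that $F^n(C)\cap D=\emptyset$, $F^{-n}(E)\cap D=\emptyset$ for $n\ge1$ and $\operatorname{diam}F^n(C),\operatorname{diam}F^{-n}(E)\to0$. $D_{N,M}$ is the homoclinic disk bounded by an arc of $W^s(0^\infty)$ and an arc of $W^u(0^\infty)$ whose intersection with $\operatorname{NW}(F)$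 consists of the points with codes satisfying $s_{-N-1}\dots s_{-1}=0^N1$ and $s_1\dots s_{M+1}=10^M$. With $\mathbb{P}=\bigcup_{i\in\mathbb{Z}}F^i(D_{N,M})$, a pruning homeomorphism associated to $D_{N,M}$ is the end map $f_{N,M}=f_1$ of an isotopy $f_t\colon F\simeq f_1$ supported in $\mathbb{P}$ with $\operatorname{NW}(f_1)=\operatorname{NW}(F)\setminus\mathbb{P}$. The pruning automorphism $\rho_{N,M}$ of $\Sigma_2$ is defined by $(\rho_{N,M}(s))_i=0$ if $s_{i-N-1}\dots s_{i+M+1}=0^N1110^M$, $=1$ if $s_{i-N-1}\dots s_{i+M+1}=0^N1010^M$, and $=s_i$ otherwise. *)

(* Defs.v *)
(* mathcomp-analysis (topology on R, R*R, C := R[i]^o,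
   Sigma_2 = int -> bool with the product topology). *)
From HB Require Import structures.
From mathcomp Require Import all_boot all_order all_algebra.
From mathcomp Require Import all_classical all_reals all_analysis.
From mathcomp Require Import complex.
Set Implicit Arguments. Unset Strict Implicit. Unset Printing Implicit Defensive.
Import Order.TTheory GRing.Theory Num.Theory.
Import numFieldNormedType.Exports numFieldTopology.Exports.
Local Open Scope ring_scope.
Local Open Scope classical_set_scope.
Local Open Scope complex_scope.

(* Generic notions                                                     *)

(* f^i for i : int, given an inverse finv of f *)
Definition iterZ {T : Type} (f finv : T -> T) (i : int) (x : T) : T :=
  match i with Posz n => iter n f x | Negz n => iter n.+1 finv x end.

(* h : A -> B is a homeomorphism (A, B with the subspace topologies)
   conjugating f|A to g|B, i.e. h o f = g o h on A. *)
Definition topconj {X Y : topologicalType} (A : set X) (f : X -> X)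
    (B : set Y) (g : Y -> Y) (h : X -> Y) : Prop :=
  [/\ (forall x, A x -> B (h x)),
      (forall x y, A x -> A y -> h x = h y -> x = y),
      (forall y, B y -> exists2 x, A x & h x = y),
      ({within A, continuous h} /\
       exists k : Y -> X,
          (forall y, B y -> A (k y) /\ h (k y) = y) /\ {within B, continuous k})
    & (forall x, A x -> h (f x) = g (h x))].

(* f|A is topologically conjugate to g|B *)
Definition top_conjugate {X Y : topologicalType} (A : set X) (f : X -> X)
    (B : set Y) (g : Y -> Y) : Prop := exists h, topconj A f B g h.

(* full 2-shift *)
Definition Sigma2 : Type := prod_topology (fun _ : int => bool).
Definition shift (s : Sigma2) : Sigma2 := fun i => s (i + 1).

Section Henon.
Variable R : realType.

Definition C := (R[i])^o.

Definition henon (a b : C) (p : C * C) : C * C :=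
  (a - p.1 ^+ 2 - b * p.2, p.1).
(* inverse of henon a b (for b != 0) *)
Definition henon_inv (a b : C) (p : C * C) : C * C :=
  (p.2, (a - p.2 ^+ 2 - p.1) / b).

(* K^C_{a,b}: points with bounded full (Z-indexed) orbit *)
Definition KC (a b : C) : set (C * C) :=
  [set p | exists Mb : R, forall i : int,
      `|(iterZ (henon a b) (henon_inv a b) i p).1| <= Mb%:C
   /\ `|(iterZ (henon a b) (henon_inv a b) i p).2| <= Mb%:C].

(* horseshoe locus H^C *)
Definition horseshoe_locus : set (C * C) :=
  [set ab | ab.2 != 0 /\
     top_conjugate (KC ab.1 ab.2) (henon ab.1 ab.2) [set: Sigma2] shift].

(* {|a| > 2(1+|b|)^2, b != 0} *)
Definition hyperbolic_region : set (C * C) :=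
  [set ab | ab.2 != 0 /\ 2 * (1 + `|ab.2|) ^+ 2 < `|ab.1|].

(* H^C_0: connected component of H^C containing hyperbolic_region *)
Definition H0 : set (C * C) :=
  [set q | exists2 p, hyperbolic_region p & connected_component horseshoe_locus p q].

(* DN, viewed inside C x C *)
Definition DN : set (C * C) :=
  [set ab | exists a b : R, ab = (a%:C, b%:C) /\ b != 0 /\
     (5 + 2 * Num.sqrt 5) * (1 + `|b|) ^+ 2 / 4 < a].

Definition I01 : set R := [set t | 0 <= t <= 1].

(* closed curve in A parametrized by [0,1] *)
Definition loop_in (A : set (C * C)) (gamma : R -> C * C) : Prop :=
  [/\ {within I01, continuous gamma}, gamma 0 = gamma 1 &
      forall t, I01 t -> A (gamma t)].

Definition conj2 (p : C * C) : C * C := ((p.1 : R[i])^*, (p.2 : R[i])^*).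

Definition symmetric_loop (gamma : R -> C * C) : Prop :=
  forall t, I01 t -> gamma (1 - t) = conj2 (gamma t).

(* rho(gamma) = rho: there is a continuous family (t,s) |-> g_t(s) = h_t^{-1}(s)
   of conjugacies g_t : (sigma, Sigma2) -> (H_{gamma t}, K^C_{gamma t}),
   t in [0,1] (the continuation of h_0 by structural stability),
   with h_1 o h_0^{-1} = rho, i.e. g_1 o rho = g_0. *)
Definition monodromy_is (gamma : R -> C * C) (rho : Sigma2 -> Sigma2) : Prop :=
  exists g : R -> Sigma2 -> C * C,
  [/\ (forall t, I01 t ->
         topconj [set: Sigma2] shift (KC (gamma t).1 (gamma t).2)
                 (henon (gamma t).1 (gamma t).2) (g t)),
      {within [set ts : R * Sigma2 | I01 ts.1], continuous (fun ts => g ts.1 ts.2)}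
    & (forall s, g 1 (rho s) = g 0 s)].

(* real Henon map and K^R *)
Definition henonR (a b : R) (z : R * R) : R * R := (a - z.1 ^+ 2 - b * z.2, z.1).
Definition KR (a b : R) : set (R * R) :=
  [set z | KC (a%:C) (b%:C) ((z.1)%:C, (z.2)%:C)].

(* Smale horseshoe and pruning                                          *)

Definition Q : set (R * R) := [set z | -1 <= z.1 <= 1 /\ -1 <= z.2 <= 1].

(* non-wandering set *)
Definition NW (f : R * R -> R * R) : set (R * R) :=
  [set x | forall U, nbhs x U ->
     exists n : nat, (0 < n)%N /\ exists2 y, U y & U (iter n f y)].

(* itinerary: 0 (false) if first coordinate of F^i z negative, 1 (true) if positive *)
Definition itin (F Finv : R * R -> R * R) (z : R * R) : Sigma2 :=
  fun i => 0 < (iterZ F Finv i z).1.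

(* standard horseshoe: diffeomorphism of the plane, affine on
   V0 = Q /\ {x <= -1 + 2/lam} (orientation preserving, onto the bottom strip)
   and V1 = Q /\ {x >= 1 - 2/lam} (orientation reversing, onto the top strip),
   Q /\ F^{-1}(Q) = V0 \/ V1, with NW(F) the invariant Cantor set in Q,
   conjugated to (sigma, Sigma2) by the itinerary map *)
Definition std_horseshoe (F Finv : R * R -> R * R) : Prop :=
  [/\ (cancel F Finv /\ cancel Finv F),
      ((forall z, differentiable F z) /\ (forall z, differentiable Finv z)),
      (exists lam mu : R, [/\ 2 < lam, 0 < mu < 1 / 2,
         (forall z, Q z -> z.1 <= -1 + 2 / lam ->
            F z = (lam * z.1 + lam - 1, mu * z.2 - 1 + mu)),
         (forall z, Q z -> 1 - 2 / lam <= z.1 ->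
            F z = (- lam * z.1 + lam - 1, - mu * z.2 + 1 - mu)) &
         (forall z, Q z -> Q (F z) -> z.1 <= -1 + 2 / lam \/ 1 - 2 / lam <= z.1)]),
      NW F = [set z | forall i : int, Q (iterZ F Finv i z)] &
      topconj (NW F) F [set: Sigma2] shift (itin F Finv)].

(* 0^infty *)
Definition zero_fixed_point (F Finv : R * R -> R * R) (p0 : R * R) : Prop :=
  NW F p0 /\ itin F Finv p0 = (fun _ => false).

Definition Ws (F : R * R -> R * R) (p : R * R) : set (R * R) :=
  [set z | (fun n : nat => iter n F z) @ \oo --> p].
Definition Wu (Finv : R * R -> R * R) (p : R * R) : set (R * R) :=
  [set z | (fun n : nat => iter n Finv z) @ \oo --> p].

(* A is an arc with endpoints e1, e2 *)
Definition is_arc (A : set (R * R)) (e1 e2 : R * R) : Prop :=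
  exists c : R -> R * R,
  [/\ {within I01, continuous c},
      (forall s t, I01 s -> I01 t -> c s = c t -> s = t),
      A = c @` I01, c 0 = e1 & c 1 = e2].

Definition open_unit_disk : set (R * R) := [set z | z.1 ^+ 2 + z.2 ^+ 2 < 1].
Definition closed_unit_disk : set (R * R) := [set z | z.1 ^+ 2 + z.2 ^+ 2 <= 1].

(* D is an open topological disk whose closure is a closed disk *)
Definition topdisk (D : set (R * R)) : Prop :=
  exists phi : R * R -> R * R,
  [/\ {within closed_unit_disk, continuous phi},
      (forall x y, closed_unit_disk x -> closed_unit_disk y -> phi x = phi y -> x = y),
      D = phi @` open_unit_disk & closure D = phi @` closed_unit_disk].

Definition dist2 (x y : R * R) : R := Num.max `|x.1 - y.1| `|x.2 - y.2|.

(* diam (A n) -> 0 *)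
Definition diam_to0 (A : nat -> set (R * R)) : Prop :=
  forall e : R, 0 < e -> \forall n \near \oo,
    forall x y, A n x -> A n y -> dist2 x y < e.

(* D is a pruning disk with boundary C \/ E *)
Definition pruning_disk (F Finv : R * R -> R * R) (D Cc E : set (R * R)) : Prop :=
  [/\ (open D /\ topdisk D),
      (exists e1 e2, [/\ e1 <> e2, is_arc Cc e1 e2, is_arc E e1 e2 &
                         Cc `&` E = [set e1; e2]]),
      closure D `\` D = Cc `|` E,
      ((forall n : nat, (0 < n)%N -> (iter n F @` Cc) `&` D = set0) /\
       (forall n : nat, (0 < n)%N -> (iter n Finv @` E) `&` D = set0)) &
      diam_to0 (fun n => iter n F @` Cc) /\
      diam_to0 (fun n => iter n Finv @` E)].

(* s_{-N-1}..s_{-1} = 0^N 1 and s_1..s_{M+1} = 1 0^M *)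
Definition code_NM (N M : nat) (s : Sigma2) : Prop :=
  [/\ (forall k : nat, (1 <= k <= N)%N -> s (- (k.+1)%:Z) = false),
      s (-1) = true, s 1 = true &
      (forall k : nat, (1 <= k <= M)%N -> s ((k.+1)%:Z) = false)].

(* D is the homoclinic disk D_{N,M}, bounded by the arc Cc of W^s(0^infty)
   and the arc E of W^u(0^infty) *)
Definition homoclinic_disk (F Finv : R * R -> R * R) (p0 : R * R) (N M : nat)
    (D Cc E : set (R * R)) : Prop :=
  [/\ Cc `<=` Ws F p0, E `<=` Wu Finv p0,
      closure D `\` D = Cc `|` E &
      D `&` NW F = [set z | NW F z /\ code_NM N M (itin F Finv z)]].

(* P = union of the F^i(D) *)
Definition orbit_set (F Finv : R * R -> R * R) (D : set (R * R)) : set (R * R) :=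
  [set z | exists i : int, exists2 w, D w & iterZ F Finv i w = z].

(* f is the end map of an isotopy F ~ f supported in P with NW(f) = NW(F) \ P *)
Definition pruning_homeo (F Finv : R * R -> R * R) (D : set (R * R))
    (f : R * R -> R * R) : Prop :=
  exists ft : R -> R * R -> R * R,
  [/\ (ft 0 = F /\ ft 1 = f),
      (forall t, I01 t -> exists g, [/\ cancel (ft t) g, cancel g (ft t),
                                        continuous (ft t) & continuous g]),
      {within [set tz : R * (R * R) | I01 tz.1], continuous (fun tz => ft tz.1 tz.2)},
      (forall t z, I01 t -> ~ orbit_set F Finv D z -> ft t z = F z) &
      NW f = NW F `\` orbit_set F Finv D].

End Henon.

(* pruning automorphism rho_{N,M} *)
Definition rhoNM (N M : nat) (s : Sigma2) : Sigma2 := fun i =>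
  if [&& [forall k : 'I_N, s (i - 1 - (k.+1)%:Z) == false], s (i - 1),
         s (i + 1) & [forall k : 'I_M, s (i + 1 + (k.+1)%:Z) == false]]
  then ~~ s i else s i.

(* Main.v *)
(** For real parameters in DN every bounded complex orbit is real.  Hence the
    complex conjugates of the points [g_(1-t) (rho s)] form a continuous path
    lying on [K_(gamma t)] which starts at [g_0 s]; the codes being totally
    disconnected, it coincides with [g_t s].  At [t = 1/2] this says that
    complex conjugation acts on codes by [rho], so the real points are exactly
    those with [rho s = s], i.e. those whose code avoids the two words exchanged
    by [rho].  These are also the codes of the points of [NW F] whose orbit
    misses the pruning disk. *)
Require Import Defs.
From HB Require Import structures.
From mathcomp Require Import all_boot all_order all_algebra.
From mathcomp Require Import all_classical all_reals all_analysis.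
From mathcomp Require Import complex.
From mathcomp Require Import ring lra zify.
Import Order.TTheory GRing.Theory Num.Theory.
Import numFieldNormedType.Exports numFieldTopology.Exports.
Import Normc.
Local Open Scope ring_scope.
Local Open Scope classical_set_scope.

(** * Moduli of complex numbers and reality of bounded orbits over [DN] *)

Lemma normC_normc (R : realType) (z : R[i]) : `|z| = real_complex R (normc z).
Proof. by case: z. Qed.

Lemma abs_Re_le (R : realType) (z : R[i]) : `|complex.Re z| <= normc z.
Proof. by case: z => a b /=; rewrite -sqrtr_sqr ler_wsqrtr // lerDl sqr_ge0. Qed.

Lemma abs_Im_le (R : realType) (z : R[i]) : `|complex.Im z| <= normc z.
Proof. by case: z => a b /=; rewrite -sqrtr_sqr ler_wsqrtr // lerDr sqr_ge0. Qed.

Lemma normc_real (R : realType) (x : R) : normc (real_complex R x) = `|x|.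
Proof. by rewrite /= expr0n addr0 sqrtr_sqr. Qed.

Lemma normc_triangle (R : realType) (x y : R[i]) : normc (x + y) <= normc x + normc y.
Proof. exact: le_normcD. Qed.

(* If [S] bounds the orbit then [a - S beta] bounds [Re (x^2)] from below; the
   Devaney-Nitecki constant is the one at which this bound reaches [beta^2/4]. *)
Lemma devaney_nitecki_gap (R : realType) (a beta S : R) :
  0 < beta -> 0 <= S -> (5 + 2 * Num.sqrt 5) * beta ^+ 2 / 4 < a ->
  S ^+ 2 <= a + beta * S -> (beta / 2) ^+ 2 < a - beta * S.
Proof.
move=> b0 S0 ha hS.
have s0 : 0 <= Num.sqrt 5 :> R by exact: sqrtr_ge0.
have s2 : Num.sqrt 5 ^+ 2 = 5 :> R by rewrite sqr_sqrtr.
move: (Num.sqrt 5) s0 s2 ha => s s0 s2 ha.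
rewrite ltNge; apply/negP => hc.
have s1 : 2 <= s by nra.
(* [w] is the larger root in [S] of [S^2 - 2 beta S - beta^2/4]. The negated goal and [hS] make this
   quadratic nonpositive, while the negated goal and the bound on [a] push [S] strictly beyond
   [w]. *)
set w := (1 + s / 2) * beta.
have hw : w < S.
  have : w * beta < S * beta by rewrite /w; nra.
  by rewrite ltr_pM2r.
have : 0 < (S - w) * (S - (1 - s / 2) * beta).
  apply: mulr_gt0; rewrite subr_gt0 //.
  by apply: (le_lt_trans _ hw); rewrite /w; nra.
have -> : (S - w) * (S - (1 - s / 2) * beta)
   = S ^+ 2 - 2 * beta * S + (1 - s ^+ 2 / 4) * beta ^+ 2 by rewrite /w; field.
rewrite s2; nra.
Qed.

(** All first coordinates have real part of modulus at least some [m > beta / 2]. The imaginary part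
    of the recurrence then gives [2 m Y <= beta Y] for the supremum [Y] of the [|Im|], which forces
    [Y = 0]. The hypothesis on [q.2] carries bounds on first coordinates over to second ones. *)
Lemma bounded_invariant_real (R : realType) (a b : R) (O : set (C R * C R)) (B : R) :
  (5 + 2 * Num.sqrt 5) * (1 + `|b|) ^+ 2 / 4 < a ->
  (forall q, O q -> O (henon (real_complex R a) (real_complex R b) q)) ->
  (forall q, O q -> exists2 p, O p & p.1 = q.2) ->
  (forall q, O q -> normc q.1 <= B) ->
  forall q, O q -> complex.Im q.1 = 0.
Proof.
move=> ha OH OHinv OB q0 Oq0.
pose beta := 1 + `|b|.
have b1 : 1 <= beta by rewrite lerDl.
have b0 : 0 < beta by lra.
pose S := sup [set normc q.1 | q in O].
have S1 q : O q -> normc q.1 <= S.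
  move=> Oq; apply: sup_upper_bound; last by exists q.
  by split; [exists (normc q.1), q | exists B => _ [p Op <-]; exact: OB].
have S2 q : O q -> normc q.2 <= S by move=> /OHinv[p Op <-]; exact: S1.
have S0 : 0 <= S by apply: le_trans (S1 _ Oq0); case: (q0.1) => ? ?; exact: sqrtr_ge0.
have a0 : 0 < a.
  apply: le_lt_trans ha; apply: divr_ge0 => //; apply: mulr_ge0 (sqr_ge0 _).
have hx2 q : O q -> normc q.1 ^+ 2 <= a + beta * S.
  move=> Oq; have := S1 _ (OH _ Oq); rewrite /henon /= => h1.
  (* Solves the recurrence for the square of the first coordinate: [q.1^2] is [a] minus the next
     first coordinate minus [b * q.2]. *)
  have e (u v w : R[i]) : v ^+ 2 = u + - (u - v ^+ 2 - w) + - w by ring.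
  rewrite [leLHS]expr2 -normcM -expr2 (e (real_complex R a) _ (real_complex R b * q.2)).
  apply: (le_trans (normc_triangle _ _ _)); rewrite normcN normcM normc_real.
  have := normc_triangle _ (real_complex R a) (- (real_complex R a - q.1 ^+ 2 - real_complex R b * q.2)).
  rewrite normcN normc_real gtr0_norm //.
  have := ler_wpM2l (normr_ge0 b) (S2 _ Oq).
  rewrite /beta; lra.
(* [S] is a supremum of moduli, not of their squares, so the bound [hx2] is passed to it through a
   square root. *)
have hS : S ^+ 2 <= a + beta * S.
  have p0 : 0 <= a + beta * S by rewrite addr_ge0 ?mulr_ge0 // ltW.
  rewrite -(sqr_sqrtr p0) ler_pXn2r ?nnegrE ?sqrtr_ge0 //.
  apply: ge_sup; first by exists (normc q0.1), q0.
  move=> _ [q Oq <-]; rewrite -(ler_pXn2r (n:=2)) ?nnegrE ?sqrtr_ge0 //.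
    by rewrite (sqr_sqrtr p0) hx2.
  by case: (q.1) => ? ?; exact: sqrtr_ge0.
have gap := devaney_nitecki_gap _ _ _ _ b0 S0 ha hS.
pose m := Num.sqrt (a - beta * S).
have c0 : 0 < a - beta * S by apply: le_lt_trans gap; exact: sqr_ge0.
have m0 : 0 <= m by exact: sqrtr_ge0.
have hm : beta / 2 < m.
  by rewrite -(ltr_pXn2r (n:=2)) ?nnegrE ?divr_ge0 ?(ltW b0) // sqr_sqrtr // ltW.
(* With [q.1 = u + iv], the real part of the recurrence bounds [u^2 - v^2], and a fortiori [u^2],
   below by [a - S - |b| S]. *)
have hu q : O q -> m <= `|complex.Re q.1|.
  move=> Oq; rewrite -(ler_pXn2r (n:=2)) ?nnegrE // sqr_sqrtr ?(ltW c0) //.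
  rewrite real_normK ?num_real //.
  have := le_trans (abs_Re_le _ _) (S1 _ (OH _ Oq)).
  have := le_trans (abs_Re_le _ _) (S2 _ Oq).
  case: q Oq => [[u v] [u' v']] Oq /=.
  rewrite !(mul0r, subr0, mulr0) => h2 h1.
  have := ler_wpM2l (normr_ge0 b) h2; rewrite -normrM => h3.
  have := ler_norm (b * u').
  have := lerNnormlW h3; have := lerNnormlW h1.
  have := ler_norm (a - (u * u - v * v) - b * u').
  rewrite /beta; nra.
pose Y := sup [set `|complex.Im q.1| | q in O].
have Y1 q : O q -> `|complex.Im q.1| <= Y.
  move=> Oq; apply: sup_upper_bound; last by exists q.
  split; first by exists `|complex.Im q.1|, q.
  by exists B => _ [p Op <-]; apply: le_trans (abs_Im_le _ _) (OB _ Op).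
have Y2 q : O q -> `|complex.Im q.2| <= Y by move=> /OHinv[p Op <-]; exact: Y1.
(* The imaginary part of the recurrence expresses [2uv] by the imaginary parts of the next first
   coordinate and of [b * q.2]. *)
have hy q : O q -> 2 * m * `|complex.Im q.1| <= beta * Y.
  move=> Oq.
  have := ler_wpM2r (normr_ge0 (complex.Im q.1)) (hu _ Oq).
  have := Y1 _ (OH _ Oq).
  have := Y2 _ Oq.
  case: q Oq => [[u v] [u' v']] Oq /=.
  rewrite !(mul0r, subr0, mulr0, addr0) => h2 h1.
  have := ler_wpM2l (normr_ge0 b) h2; rewrite -!normrM => h3 h4.
  have e : 2 * (u * v) = - (0 - (u * v + v * u) - b * v') - b * v' by ring.
  have := ler_normB (- (0 - (u * v + v * u) - b * v')) (b * v').
  rewrite -e normrN normrM ger0_norm // /beta.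
  move: h1; rewrite !sub0r; lra.
have Ym : 2 * m * Y <= beta * Y.
  have m2 : 0 < 2 * m by lra.
  rewrite mulrC -ler_pdivlMr //; apply: ge_sup; first by exists `|complex.Im q0.1|, q0.
  by move=> _ [q Oq <-]; rewrite ler_pdivlMr // mulrC hy.
apply/eqP; rewrite -normr_le0; apply: le_trans (Y1 _ Oq0) _; nra.
Qed.

(** * Continuity on subsets, conjugation and real parts *)

Lemma within_continuous_comp (X Y Z : topologicalType) (A : set X) (B : set Y)
    (f : X -> Y) (g : Y -> Z) :
  {within A, continuous f} -> (forall x, A x -> B (f x)) ->
  {within B, continuous g} -> {within A, continuous (fun x => g (f x))}.
Proof.
move=> /subspace_continuousP cf fAB /subspace_continuousP cg.
apply/subspace_continuousP => x Ax.
apply: (@cvg_comp _ _ _ f g _ (within B (nbhs (f x)))); last exact: cg (fAB _ Ax).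
move=> U hU; have h : nbhs x [set y | A y -> B (f y) -> U (f y)] := cf x Ax _ hU.
rewrite -[_ U]/(nbhs x [set y | A y -> U (f y)]).
by apply: filterS h => y h Ay; exact: h Ay (fAB _ Ay).
Qed.

(** At a point of the closure, the trace of the neighbourhood filter on the equalizer is proper;
    along it [f] and [g] agree, so their limits coincide. *)
Lemma closed_equalizer (X Y : topologicalType) (A : set X) (f g : X -> Y) :
  hausdorff_space Y -> closed A ->
  {within A, continuous f} -> {within A, continuous g} ->
  closed [set x | A x /\ f x = g x].
Proof.
move=> hY cA /subspace_continuousP cf /subspace_continuousP cg x.
set E := [set x | _] => clx.
have Ax : A x by apply: cA; apply: closure_subset clx => y [].
split=> //.
have PF := within_nbhs_proper clx.
have sub : within E (nbhs x) `=>` within A (nbhs x).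
  by move=> U; rewrite /within /=; apply: filterS => y h [Ay _]; exact: h.
have h1 : f @ within E (nbhs x) --> f x.
  by apply: cvg_trans (cf _ Ax); exact: cvg_app sub.
have h2 : g @ within E (nbhs x) --> g x.
  by apply: cvg_trans (cg _ Ax); exact: cvg_app sub.
apply: (@cvg_unique _ hY (f @ within E (nbhs x)) _ (f x) (g x)) => //.
apply: cvg_trans h2; apply: near_eq_cvg.
apply: (@filterS _ (nbhs x) _ setT); last exact: filterT.
by move=> y _ [_ ->].
Qed.

Lemma continuous_conjc (R : realType) : continuous (conjc : C R -> C R).
Proof.
move=> z; apply/(@cvgrPdist_lt R[i] (C R) (C R) (nbhs (z : C R)) (nbhs_filter (z : C R))) => e e0; near=> w.
have -> : conjc z - conjc w = conjc (z - w) by rewrite rmorphB.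
rewrite normcJ; near: w.
exact: (@cvgr_dist_lt _ _ _ _ _ id z).
Unshelve. all: by end_near.
Qed.

Lemma continuous_conj2 (R : realType) : continuous (@conj2 R).
Proof.
move=> [z w].
have h1 : (fun p : C R * C R => conjc p.1 : C R) @ nbhs (z, w) --> (conjc z : C R).
  exact: (@cvg_comp _ _ _ fst (conjc : C R -> C R) _ _ _ cvg_fst (@continuous_conjc R z)).
have h2 : (fun p : C R * C R => conjc p.2 : C R) @ nbhs (z, w) --> (conjc w : C R).
  exact: (@cvg_comp _ _ _ snd (conjc : C R -> C R) _ _ _ cvg_snd (@continuous_conjc R w)).
exact: cvg_pair h1 h2.
Qed.

Lemma continuous_real_complex (R : realType) : continuous (real_complex R : R -> C R).
Proof.
move=> x; apply/cvgrPdist_lt => e e0.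
have e1 : 0 < complex.Re e by move: e0; rewrite ltcE => /andP[].
near=> y.
have ee : e = real_complex R (complex.Re e).
  by case: (e) e0 => u v; rewrite ltcE /= => /andP[/eqP->].
have -> : real_complex R x - real_complex R y = real_complex R (x - y) by rewrite rmorphB.
rewrite normC_normc normc_real ee ltcR.
near: y; exact: (@cvgr_dist_lt _ _ _ _ _ id x).
Unshelve. all: by end_near.
Qed.

Lemma continuous_Re (R : realType) : continuous (@complex.Re R : C R -> R).
Proof.
move=> z; apply/(@cvgrPdist_lt R R (C R) (nbhs (z : C R)) (nbhs_filter (z : C R))) => e e0; near=> w.
have -> : complex.Re z - complex.Re w = complex.Re ((z : R[i]) - w).
  by case: (z) (w) => ? ? [].
apply: le_lt_trans (abs_Re_le _ _) _.
rewrite -ltcR -normC_normc; near: w.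
by apply: (@cvgr_dist_lt _ _ _ _ _ id z); rewrite // ltcR.
Unshelve. all: by end_near.
Qed.

(** * Compact cylinders and uniqueness of continuation *)

Lemma compact_Sigma2_cylinder (i : int) (c : bool) : compact [set u : Sigma2 | u i = c].
Proof.
have cT : compact [set: Sigma2].
  have -> : [set: Sigma2] = [set u : Sigma2 | forall j : int, [set: bool] (u j)].
    by apply/seteqP; split.
  exact: (@tychonoff int (fun=> bool) (fun=> setT) (fun=> bool_compact)).
have -> : [set u : Sigma2 | u i = c] = proj (T := fun=> bool) i @^-1` [set c] by [].
apply: (subclosed_compact _ cT) => //.
apply: closed_comp; last exact: discrete_closed.
by move=> u _; exact: proj_continuous.
Qed.

Lemma I01_itv (R : realType) : @I01 R = `[0, 1]%classic.
Proof. by apply/seteqP; split=> t; rewrite /I01 /= in_itv. Qed.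

(* A path lying on a continuous family of embedded Cantor sets has a constant
   code: fixing one coordinate of the code splits [0,1] into two disjoint compact sets. *)
Lemma continuation_unique (R : realType) (Y : topologicalType)
    (g : R -> Sigma2 -> Y) (x : R -> Y) (s0 : Sigma2) :
  hausdorff_space Y ->
  {within [set ts : R * Sigma2 | @I01 R ts.1], continuous (fun ts => g ts.1 ts.2)} ->
  (forall t u v, @I01 R t -> g t u = g t v -> u = v) ->
  {within @I01 R, continuous x} ->
  (forall t, @I01 R t -> exists u, g t u = x t) ->
  g 0 s0 = x 0 ->
  forall t, @I01 R t -> g t s0 = x t.
Proof.
move=> hY cg gI cx gx g0.
have I0 : @I01 R 0 by rewrite /I01 /= lexx ler01.
(* The times at which the code of [x t] has symbol [c] at place [i]. *)
pose A (i : int) (c : bool) := [set t | @I01 R t /\ exists u : Sigma2, u i = c /\ g t u = x t].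
have clA i c : closed (A i c).
  apply: compact_closed; first exact: norm_hausdorff.
  pose Z := [set ts : R * Sigma2 | @I01 R ts.1 /\ g ts.1 ts.2 = x ts.1].
  have cZ : closed Z.
    apply: (closed_equalizer _ _ _ _ _ hY) => //.
      apply: (@closed_comp _ _ (fst : R * Sigma2 -> R)); first by move=> ? _; exact: cvg_fst.
      by rewrite I01_itv; exact: itv_closed.
    apply: (within_continuous_comp _ _ _ _ _ _ _ _ _ cx) => //.
    by apply: continuous_subspaceT => ?; exact: cvg_fst.
  (* Projecting to time a closed part of the compact product of [[0,1]] with a cylinder yields a
     compact set. *)
  have -> : A i c = fst @` ((@I01 R `*` [set u : Sigma2 | u i = c]) `&` Z).
    apply/seteqP; split=> [t [It [u [ui gu]]]|t [[t' u] [[/= It ui] [_ gu]] <-]].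
      by exists (t, u).
    by split=> //; exists u.
  apply: continuous_compact.
    by apply: continuous_subspaceT => ?; exact: cvg_fst.
  apply: compact_closedI => //; apply: compact_setX; last exact: compact_Sigma2_cylinder.
  by rewrite I01_itv; exact: segment_compact.
have Aall i t : @I01 R t -> A i (s0 i) t.
  move=> It; suff -> : A i (s0 i) = @I01 R by [].
  (* [A i (s0 i)] contains 0 and is closed. It is also relatively open: by injectivity of [g t] its
     complement in [[0,1]] is the closed set of the opposite symbol. *)
  have := @segment_connected R 0 1 (A i (s0 i)); rewrite -I01_itv; apply.
  - by exists 0; split=> //; exists s0.
  - exists (~` A i (~~ s0 i)); first exact: closed_openC.
    apply/seteqP; split=> [r [Ir [u [ui gu]]]|r [Ir nA]].
      split=> // -[_ [v [vi gv]]]; move: vi; rewrite -(gI r u v) // ?gv //.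
      by rewrite ui; case: (s0 i).
    split=> //; have [u gu] := gx _ Ir; exists u; split=> //.
    apply/eqP; apply: contra_notT nA => ne; split=> //; exists u; split=> //.
    by move: ne; case: (u i) (s0 i) => -[].
  - by exists (A i (s0 i)) => //; apply/seteqP; split=> [r Ar|r []//]; split=> //; case: Ar.
move=> t It; have [u gu] := gx _ It.
suff -> : s0 = u by [].
apply: boolp.funext => i; have [_ [v [vi gv]]] := Aall i t It.
by rewrite -vi (gI t v u) // gv.
Qed.

(** * Integer iterates, and complex conjugation on Hénon orbits *)

Lemma iterZ_succ (T : Type) (f finv : T -> T) (i : int) (x : T) :
  cancel finv f -> iterZ f finv (i + 1) x = f (iterZ f finv i x).
Proof.
move=> fK; case: i => [n|[|n]].
- by rewrite (_ : Posz n + 1 = Posz n.+1) //; lia.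
- by rewrite (_ : Negz 0 + 1 = Posz 0) //= fK.
- by rewrite (_ : Negz n.+1 + 1 = Negz n) /= ?fK //; lia.
Qed.

Lemma iterZ_pred (T : Type) (f finv : T -> T) (i : int) (x : T) :
  cancel f finv -> iterZ f finv (i - 1) x = finv (iterZ f finv i x).
Proof.
move=> fK; case: i => [[|n]|n] //.
- by rewrite (_ : Posz n.+1 - 1 = Posz n) /= ?fK //; lia.
- by rewrite (_ : Negz n - 1 = Negz n.+1) //; lia.
Qed.

Lemma iterZD (T : Type) (f finv : T -> T) (i j : int) (x : T) :
  cancel f finv -> cancel finv f ->
  iterZ f finv (i + j) x = iterZ f finv i (iterZ f finv j x).
Proof.
move=> fK fvK; elim/int_rect: i => [|n IH|n IH]; first by rewrite add0r.
- by rewrite -addn1 PoszD addrAC !iterZ_succ // IH.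
- by rewrite -addn1 PoszD opprD addrAC !iterZ_pred // IH.
Qed.

Lemma iterZ_morph (T U : Type) (f finv : T -> T) (g ginv : U -> U) (h : T -> U) :
  (forall x, h (f x) = g (h x)) -> (forall x, h (finv x) = ginv (h x)) ->
  forall i x, h (iterZ f finv i x) = iterZ g ginv i (h x).
Proof.
move=> hf hfv [] n x /=; first by elim: n => //= n <-.
by elim: n => [|n IH] /=; rewrite hfv // -IH.
Qed.

Lemma henonK (R : realType) (a b : C R) :
  b != 0 -> cancel (henon a b) (henon_inv a b).
Proof.
move=> b0 [x y]; rewrite /henon /henon_inv /=; congr pair.
have e (u v w : R[i]) : u - v - (u - v - w) = w by ring.
by rewrite e mulrAC divff ?mul1r.
Qed.

Lemma henon_invK (R : realType) (a b : C R) :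
  b != 0 -> cancel (henon_inv a b) (henon a b).
Proof.
move=> b0 [x y]; rewrite /henon /henon_inv /=; congr pair.
have e (u v w : R[i]) : u - v - (u - v - w) = w by ring.
by rewrite mulrCA divff // mulr1 e.
Qed.

Lemma henon_conj2 (R : realType) (a b : C R) (p : C R * C R) :
  conj2 (henon a b p) = henon (conj2 (a, b)).1 (conj2 (a, b)).2 (conj2 p).
Proof. by rewrite /conj2 /henon /= !rmorphB rmorphXn rmorphM. Qed.

Lemma henon_inv_conj2 (R : realType) (a b : C R) (p : C R * C R) :
  conj2 (henon_inv a b p) = henon_inv (conj2 (a, b)).1 (conj2 (a, b)).2 (conj2 p).
Proof. by rewrite /conj2 /henon_inv /= fmorph_div !rmorphB rmorphXn. Qed.

Lemma KC_conj2 (R : realType) (q p : C R * C R) :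
  KC q.1 q.2 p -> KC (conj2 q).1 (conj2 q).2 (conj2 p).
Proof.
case: q => a b [B hB]; exists B => i.
rewrite -(iterZ_morph _ _ _ _ _ _ _ (henon_conj2 _ a b) (henon_inv_conj2 _ a b)).
by rewrite /conj2 /= !normcJ; exact: hB.
Qed.

(** The full orbit of [p] is a bounded invariant set, so [bounded_invariant_real] applies to it. *)
Lemma DN_KC_conj2 (R : realType) (q p : C R * C R) :
  @DN R q -> KC q.1 q.2 p -> conj2 p = p.
Proof.
move=> [a [b [-> [b0 hab]]]] /= [B hB].
set A := real_complex R a in hB; set Bc := real_complex R b in hB.
have Bc0 : Bc != 0 by rewrite /Bc fmorph_eq0.
pose O : set (C R * C R) := [set iterZ (henon A Bc) (henon_inv A Bc) i p | i in setT].
have OH r : O r -> O (henon A Bc r).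
  by move=> [i _ <-]; exists (i + 1) => //; rewrite iterZ_succ //; exact: henon_invK.
have OHv r : O r -> O (henon_inv A Bc r).
  by move=> [i _ <-]; exists (i - 1) => //; rewrite iterZ_pred //; exact: henonK.
have OB r : O r -> normc r.1 <= B.
  by move=> [i _ <-]; have [h _] := hB i; rewrite -lecR -normC_normc.
have OI r : O r -> complex.Im r.1 = 0.
  apply: (bounded_invariant_real _ a b O B) => // s /OHv ?; by exists (henon_inv A Bc s).
have Op : O p by exists 0.
(* The second coordinate of [p] is the first coordinate of its preimage, so the statement on first
   coordinates settles both. *)
have := OI _ (OHv _ Op); have := OI _ Op.
by case: (p) => [[x y] [x' y']] /= -> ->; rewrite /conj2 /= oppr0.
Qed.

(** * Fixed codes of the pruning automorphism and pruned points *)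

(** [code_NM] leaves the central symbol free, so it covers both exchanged words; wherever one
    occurs, [rhoNM] negates that symbol and changes the code. *)
Lemma rhoNM_fixedP (N M : nat) (s : Sigma2) :
  rhoNM N M s = s <-> forall i, ~ code_NM N M (fun j => s (i + j)).
Proof.
split=> [fix_s i [h1 h2 h3 h4]|nocode].
  have := congr1 (fun u : Sigma2 => u i) fix_s; rewrite /rhoNM.
  rewrite ifT; first by case: (s i).
  apply/and4P; split => //.
  - apply/forallP => k; have /h1 : (1 <= k.+1 <= N)%N by have := ltn_ord k; lia.
    by move=> /eqP; rewrite (_ : i + _ = i - 1 - k.+1%:Z) //; lia.
  - apply/forallP => k; have /h4 : (1 <= k.+1 <= M)%N by have := ltn_ord k; lia.
    by move=> /eqP; rewrite (_ : i + _ = i + 1 + k.+1%:Z) //; lia.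
apply: boolp.funext => i; rewrite /rhoNM; case: ifP => // /and4P[/forallP h1 h2 h3 /forallP h4].
exfalso; apply: (nocode i); split => // k kN.
(* The ordinals in [rhoNM] start at 0, whereas [code_NM] counts from 1. *)
- have kN' : (k.-1 < N)%N by lia.
  by have /eqP := h1 (Ordinal kN'); rewrite (_ : i - 1 - _ = i - k.+1%:Z) //=; lia.
- have kN' : (k.-1 < M)%N by lia.
  by have /eqP := h4 (Ordinal kN'); rewrite (_ : i + 1 + _ = i + k.+1%:Z) //=; lia.
Qed.

Lemma itin_iterZ (R : realType) (F Finv : R * R -> R * R) (i : int) (z : R * R) :
  cancel F Finv -> cancel Finv F ->
  itin F Finv (iterZ F Finv i z) = (fun j => itin F Finv z (i + j)).
Proof.
move=> FK FvK; apply: boolp.funext => j.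
by rewrite /itin -iterZD // addrC.
Qed.

(** A point lies in the [i]-th image of [D] when its [-i]-th iterate lies in [D]; on [NW F] this
    means that its code shifted by [-i] satisfies [code_NM]. *)
Lemma NW_pruned (R : realType) (F Finv : R * R -> R * R) (p0 : R * R) (N M : nat)
    (D Cc E : set (R * R)) :
  std_horseshoe F Finv -> homoclinic_disk F Finv p0 N M D Cc E ->
  NW F `\` orbit_set F Finv D =
    [set z | NW F z /\ rhoNM N M (itin F Finv z) = itin F Finv z].
Proof.
move=> [[FK FvK] _ _ NWE _] [_ _ _ DE].
(* Invariance comes from the description of [NW F] by full orbits contained in [Q]. *)
have NWi i z : NW F z -> NW F (iterZ F Finv i z).
  by rewrite NWE => h j; rewrite -iterZD //; exact: h.
apply/seteqP; split=> z [Nz hz]; split=> //.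
- apply/rhoNM_fixedP => i; rewrite -itin_iterZ // => code.
  apply: hz; exists (- i), (iterZ F Finv i z); last by rewrite -iterZD // addNr.
  suff : (D `&` NW F) (iterZ F Finv i z) by case.
  by rewrite DE; split=> //; exact: NWi.
- move=> [i [w Dw zE]]; move/rhoNM_fixedP: hz => /(_ (- i)); apply.
  have wE : w = iterZ F Finv (- i) z by rewrite -zE -iterZD // addNr.
  rewrite -itin_iterZ // -wE.
  suff : (D `&` NW F) w by rewrite DE => -[].
  by split=> //; rewrite wE; exact: NWi.
Qed.

(** * Complex conjugation along a symmetric loop *)

Lemma monodromy_conj2 (R : realType) (gamma : R -> C R * C R) (rho : Sigma2 -> Sigma2)
    (g : R -> Sigma2 -> C R * C R) :
  symmetric_loop gamma -> @DN R (gamma 0) ->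
  (forall t, I01 t -> topconj [set: Sigma2] Defs.shift (KC (gamma t).1 (gamma t).2)
                 (henon (gamma t).1 (gamma t).2) (g t)) ->
  {within [set ts : R * Sigma2 | I01 ts.1], continuous (fun ts => g ts.1 ts.2)} ->
  (forall s, g 1 (rho s) = g 0 s) ->
  forall t s, I01 t -> conj2 (g (1 - t) (rho s)) = g t s.
Proof.
move=> gsym gDN gconj gcont gmon t s It; apply/esym.
have I1B r : @I01 R r -> @I01 R (1 - r) by rewrite /I01 /= => ?; lra.
apply: (continuation_unique _ _ g (fun t => conj2 (g (1 - t) (rho s)))) => //.
- by move=> r u v Ir; have [_ inj _ _ _] := gconj r Ir; exact: inj.
- have c1 : {within @I01 R, continuous (fun r => (1 - r, rho s))}.
    apply: continuous_subspaceT => r.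
    have h1 : (fun r : R => 1 - r) @ nbhs r --> 1 - r by apply: cvgB; [exact: cvg_cst|exact: cvg_id].
    have h2 : (fun=> rho s) @ nbhs r --> rho s by exact: cvg_cst.
    exact: cvg_pair h1 h2.
  have c2 := within_continuous_comp _ _ _ _ _ _ _ c1 I1B gcont.
  have c3 : {within setT, continuous (@conj2 R)}.
    by apply: continuous_subspaceT; exact: continuous_conj2.
  exact: (within_continuous_comp _ _ _ _ _ _ _ c2 (fun _ _ => I) c3).
- move=> r Ir; have Ir' := I1B r Ir.
  have [_ _ sur _ _] := gconj r Ir.
  have [into _ _ _ _] := gconj _ Ir'.
  (* Symmetry at time [1 - r]: conjugation carries the bounded set over [gamma (1 - r)] to the one
     over [gamma r]. *)
  have := gsym _ Ir'; rewrite opprB addrC subrK => e.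
  have : KC (gamma r).1 (gamma r).2 (conj2 (g (1 - r) (rho s))).
    by rewrite e; apply: KC_conj2; exact: into.
  by move=> /sur[u _ <-]; exists u.
(* At time 0 the monodromy relation turns [g 1 (rho s)] into [g 0 s], a real point because [gamma 0]
   lies in [DN]. *)
- rewrite subr0 gmon; apply/esym; apply: DN_KC_conj2 gDN _.
  have I0 : @I01 R 0 by rewrite /I01 /= lexx ler01.
  by have [into _ _ _ _] := gconj 0 I0; exact: into.
Qed.

(** * The real plane as the fixed set of conjugation *)

Definition complexify (R : realType) (z : R * R) : C R * C R :=
  (real_complex R z.1, real_complex R z.2).

Definition real_part (R : realType) (p : C R * C R) : R * R :=
  (complex.Re (p.1 : R[i]), complex.Re (p.2 : R[i])).

Lemma complexifyK (R : realType) : cancel (@complexify R) (@real_part R).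
Proof. by case. Qed.

Lemma conj2K (R : realType) : involutive (@conj2 R).
Proof. by case=> [[? ?] [? ?]]; rewrite /conj2 /= !opprK. Qed.

Lemma conj2_complexify (R : realType) (z : R * R) : conj2 (complexify _ z) = complexify _ z.
Proof. by rewrite /conj2 /complexify /= oppr0. Qed.

Lemma conj2_fixed (R : realType) (p : C R * C R) :
  conj2 p = p -> p = complexify _ (real_part _ p).
Proof.
have im0 (x : R) : - x = x -> x = 0 by lra.
by case: p => [[x y] [x' y']] [/im0 -> /im0 ->].
Qed.

Lemma complexify_henonR (R : realType) (a b : R) (z : R * R) :
  complexify _ (henonR a b z) = henon (real_complex R a) (real_complex R b) (complexify _ z).
Proof. by rewrite /complexify /henon /henonR /= !rmorphB rmorphXn rmorphM. Qed.

Lemma continuous_complexify (R : realType) : continuous (@complexify R).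
Proof.
move=> [z w].
have h1 : (fun p : R * R => real_complex R p.1 : C R) @ nbhs (z, w) --> (real_complex R z : C R).
  exact: (@cvg_comp _ _ _ fst (real_complex R : R -> C R) _ _ _ cvg_fst (@continuous_real_complex R z)).
have h2 : (fun p : R * R => real_complex R p.2 : C R) @ nbhs (z, w) --> (real_complex R w : C R).
  exact: (@cvg_comp _ _ _ snd (real_complex R : R -> C R) _ _ _ cvg_snd (@continuous_real_complex R w)).
exact: cvg_pair h1 h2.
Qed.

Lemma continuous_real_part (R : realType) : continuous (@real_part R).
Proof.
move=> [z w].
have h1 : (fun p : C R * C R => complex.Re (p.1 : R[i])) @ nbhs (z, w) --> complex.Re (z : R[i]).
  exact: (@cvg_comp _ _ _ fst (@complex.Re R : C R -> R) _ _ _ cvg_fst (@continuous_Re R z)).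
have h2 : (fun p : C R * C R => complex.Re (p.2 : R[i])) @ nbhs (z, w) --> complex.Re (w : R[i]).
  exact: (@cvg_comp _ _ _ snd (@complex.Re R : C R -> R) _ _ _ cvg_snd (@continuous_Re R w)).
exact: cvg_pair h1 h2.
Qed.

(** * Construction of the conjugacy through codes *)

Theorem theorem4p2 (R : realType) (F Finv : R * R -> R * R) (p0 : R * R)
    (N M : nat) (D Cc E : set (R * R)) (f : R * R -> R * R)
    (gamma : R -> C R * C R) :
  std_horseshoe F Finv ->
  zero_fixed_point F Finv p0 ->
  homoclinic_disk F Finv p0 N M D Cc E ->
  pruning_disk F Finv D Cc E ->
  pruning_homeo F Finv D f ->
  loop_in (@H0 R) gamma ->
  symmetric_loop gamma ->
  @DN R (gamma 0) ->
  monodromy_is gamma (rhoNM N M) ->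
  top_conjugate (KR (complex.Re ((gamma (1 / 2)).1 : R[i])) (complex.Re ((gamma (1 / 2)).2 : R[i])))
    (henonR (complex.Re ((gamma (1 / 2)).1 : R[i])) (complex.Re ((gamma (1 / 2)).2 : R[i])))
    (NW f) f.
Proof.
move=> horse _ disk _ [ft [[_ <-] _ _ ft_out NWf]] _ gsym gDN [g [gconj gcont gmon]].
have NWfE := NW_pruned _ _ _ _ _ _ _ _ _ horse disk; rewrite -NWf in NWfE.
set half : R := 1 / 2.
have Ih : @I01 R half by rewrite /I01 /half /=; lra.
have halfE : 1 - half = half by rewrite /half; lra.
have real_iff (s : Sigma2) : conj2 (g half (rhoNM N M s)) = g half s.
  by have := monodromy_conj2 _ _ _ _ gsym gDN gconj gcont gmon half s Ih; rewrite halfE.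
(* The time 1/2 is fixed by [t -> 1 - t], so [gamma half] is its own conjugate and the parameters
   are real. *)
have ab_real := gsym _ Ih; rewrite halfE in ab_real.
have abE := conj2_fixed _ _ (esym ab_real).
have [gin ginj _ [gc [kg [kgK kgc]]] gsh] := gconj _ Ih.
have [_ _ _ _ [Fin Finj _ [itc [kF [kFK kFc]]] itsh]] := horse.
move: abE gin kgK kgc gsh; rewrite /complexify /real_part.
set a := complex.Re _; set b := complex.Re _ => -> /= gin kgK kgc gsh.
have NWfF z : NW (ft 1) z -> NW F z /\ rhoNM N M (itin F Finv z) = itin F Finv z.
  by rewrite NWfE.
have ginj' (s u : Sigma2) : g half s = g half u -> s = u by exact: ginj.
(* A real point with code [s] is self-conjugate, so [real_iff] makes [g half] take the same value at
   [s] and at its image under [rhoNM]; injectivity concludes. *)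
have fixed_code z : KR a b z -> rhoNM N M (kg (complexify _ z)) = kg (complexify _ z).
  move=> /kgK[_ gz]; apply: ginj'.
  by rewrite -[LHS]conj2K real_iff gz conj2_complexify.
have g_real s : rhoNM N M s = s -> g half s = complexify _ (real_part _ (g half s)).
  by move=> fix_s; apply: conj2_fixed; rewrite -{1}fix_s real_iff.
have kg_g s : kg (g half s) = s by apply: ginj'; have [] := kgK _ (gin s I).
have g_shift s : KC (real_complex R a) (real_complex R b) (g half s) := gin s I.
have h_NW z : KR a b z -> NW F (kF (kg (complexify _ z))) /\
    itin F Finv (kF (kg (complexify _ z))) = kg (complexify _ z).
  by move=> _; exact: kFK.
have h_in z : KR a b z -> NW (ft 1) (kF (kg (complexify _ z))).
  by move=> Kz; have [Nh ih] := h_NW z Kz; rewrite NWfE; split; rewrite // ih fixed_code.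
(* The inverse map: read the itinerary, take the bounded point with that code, and drop its
   imaginary part, which vanishes by [g_real]. *)
pose k y := real_part _ (g half (itin F Finv y)).
have kE y : NW (ft 1) y -> complexify _ (k y) = g half (itin F Finv y).
  by move=> /NWfF[_ fy]; rewrite /k -g_real.
have k_in y : NW (ft 1) y -> KR a b (k y).
  by move=> /kE e; rewrite /KR /= -/(complexify _ (k y)) e.
have hk y : NW (ft 1) y -> kF (kg (complexify _ (k y))) = y.
  move=> Ny; have [Nh ih] := h_NW _ (k_in _ Ny); have [NFy _] := NWfF _ Ny.
  by apply: Finj => //; rewrite ih kE // kg_g.
(* [kg] reads the code of a bounded point, and [kF] returns the horseshoe point with that
   itinerary. *)
exists (fun z => kF (kg (complexify _ z))); split.
- exact: h_in.
- move=> z z' Kz Kz' e.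
  have [_ ih] := h_NW z Kz; have [_ ih'] := h_NW z' Kz'.
  have [_ gz] := kgK _ Kz; have [_ gz'] := kgK _ Kz'.
  apply: (can_inj (@complexifyK R)).
  by rewrite -[LHS]gz -[RHS]gz' -ih -ih' e.
- by move=> y Ny; exists (k y); [exact: k_in|exact: hk].
- split.
    have c1 : {within KR a b, continuous (@complexify R)}.
      by apply: continuous_subspaceT; exact: continuous_complexify.
    have c2 := within_continuous_comp _ _ _ _ _ _ _ c1 (fun _ h => h) kgc.
    exact: (within_continuous_comp _ _ _ _ _ _ _ c2 (fun _ _ => I) kFc).
  exists k; split=> [y Ny|]; first by split; [exact: k_in|exact: hk].
  have c1 : {within NW (ft 1), continuous (itin F Finv)}.
    by apply: continuous_subspaceW itc => y /NWfF[].
  have c2 := within_continuous_comp _ _ _ _ _ _ _ c1 (fun _ _ => I) gc.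
  have c3 : {within setT, continuous (@real_part R)}.
    by apply: continuous_subspaceT; exact: continuous_real_part.
  exact: (within_continuous_comp _ _ _ _ _ _ _ c2 (fun _ _ => I) c3).
- move=> z Kz.
  have [_ gz] := kgK _ Kz.
  have Nh := h_in _ Kz.
  have ez : complexify _ (henonR a b z) = g half (Defs.shift (kg (complexify _ z))).
    by rewrite gsh // gz complexify_henonR.
  have Kz' : KR a b (henonR a b z).
    by rewrite /KR /= -/(complexify _ (henonR a b z)) ez.
  have [NF ih] := h_NW _ Kz; have [NF' ih'] := h_NW _ Kz'.
  (* Points of [NW (ft 1)] lie outside the support of the isotopy, where [ft 1] equals [F]. *)
  have -> : ft 1 (kF (kg (complexify _ z))) = F (kF (kg (complexify _ z))).
    apply: ft_out; first by rewrite /I01 /= ler01 lexx.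
    by move: Nh; rewrite NWf => -[].
  (* Both points lie in [NW F], so it suffices to compare itineraries; both equal the shifted code
     of [z]. *)
  apply: Finj => //; first last.
    by rewrite ih' itsh // ih ez kg_g.
  have [_ _ _ NFQ _] := horse; move: NF; rewrite NFQ => NF i.
  by have [[FK FvK] _ _ _ _] := horse; rewrite -[F _]/(iterZ F Finv 1 _) -iterZD //; exact: NF.
Qed.
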